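(* $$\sum_{\pi\in\mathcal{G}_O^{N}}q^{|\pi|}=\frac{1}{(q;q)_\infty}\sum_{n\geq 1}q^n(q^2;q^2)_{n-1}=(-q;q)_\infty\sum_{n\geq0} \frac{q^{2n+1}}{1-q^{2n+1}}\frac{1}{(q^2;q^2)_n} .$$
   Context: An overpartition is a finite non-increasing sequence of positive integers (its parts) in which the first occurrence of each number may be overlined (so for each size $t$ at most one part of size $t$ is overlined); the size of a part $t$ or $\overline{t}$ is $t$, and the weight $|\pi|$ is the sum of the sizes of the parts. $\mathcal{G}_O^{N}$ is the set of overpartitions in which at least one non-overlined part appears and the sizes of all non-overlined parts are greater than the sizes of all overlined parts (if any). Here $|q|<1$ (or $q$ is a formal variable), $(a;q)_\infty=\prod_{i=0}^{\infty}(1-aq^i)$ and $(a;q)_n=\prod_{i=0}^{n-1}(1-aq^i)$. *)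

(* Defs.v *)
From mathcomp Require Import all_boot all_order all_algebra.
From mathcomp Require Import all_classical all_reals all_analysis.
From mathcomp Require Import complex.
Set Implicit Arguments.
Unset Strict Implicit.
Unset Printing Implicit Defensive.
Import Order.TTheory GRing.Theory Num.Theory numFieldNormedType.Exports.
Local Open Scope classical_set_scope.
Local Open Scope ring_scope.

(* The complex numbers over R. MathComp-Analysis attaches the norm topology to
   the carrier of a packed numClosedFieldType, but not to R[i] itself. *)
Definition Cplx (R : realType) : numClosedFieldType := R[i].

(* A part is a pair (size, overlined?). *)
Definition part : Type := (nat * bool)%type.
Definition psize (x : part) : nat := x.1.
Definition overlined (x : part) : bool := x.2.

(* The third condition says that an overlined part is never preceded by a part
   of the same size, i.e. only a first occurrence may be overlined. *)
Definition is_overpartition (s : seq part) : bool :=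
  [&& all (fun x => 0 < psize x)%N s,
      sorted geq (map psize s)
    & pairwise (fun x y => overlined y ==> (psize x != psize y)) s].

Definition overpartition := {s : seq part | is_overpartition s}.

Definition weight (p : overpartition) : nat := sumn (map psize (val p)).

Definition in_GON (p : overpartition) : bool :=
  has (fun x => ~~ overlined x) (val p) &&
  all (fun x => all (fun y =>
    ~~ overlined x && overlined y ==> (psize y < psize x)%N) (val p)) (val p).

Definition GON := {p : overpartition | in_GON p}.

Definition qpoch (K : pzRingType) (a q : K) (n : nat) : K :=
  \prod_(0 <= i < n) (1 - a * q ^+ i).

Definition qpoch_inf (K : numClosedFieldType) (a q : K) : K :=
  limn (qpoch a q).

(* MathComp-Analysis interprets this notation only for extended reals. *)
Notation "\sum_ ( m <= i <oo ) F" :=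
  (\big[+%R/0%R]_(m <= i <oo) F%R) : ring_scope.

(* Main.v *)
Require Import Defs.
From mathcomp Require Import all_boot all_order all_algebra.
From mathcomp Require Import all_classical all_reals all_analysis.
From mathcomp.analysis Require Import showcase.summability.
From mathcomp Require Import complex finmap ring lra zify.
Import Order.TTheory GRing.Theory Num.Theory numFieldNormedType.Exports.
Local Open Scope classical_set_scope.
Local Open Scope ring_scope.

#[local] Existing Instance totally_filter.

Set Implicit Arguments.
Unset Strict Implicit.
Unset Printing Implicit Defensive.

(** Removing the overlined parts from an element of G_O^N whose smallest
    non-overlined part is n leaves a partition with smallest part n, and the
    overlined parts are distinct and smaller than n. With all parts at most N
    this gives
      sum_(n <= N) q^n (-q;q)_(n-1) / ((1-q^n)...(1-q^N))
        = (q;q)_N^-1 sum_(n <= N) q^n (q^2;q^2)_(n-1),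
    which is obtained by induction on the largest part; N -> oo is the first
    identity.

    For the second one put p = q^2 and
      A(z) = sum_(n >= 1) z^n (p;p)_(n-1),
      B(z) = sum_(k >= 0) z p^k / (1 - z p^k) / (p;p)_k.
    Since sum_(k <= n) p^k / (p;p)_k = 1 / (p;p)_n, both A and (p;p)_oo B satisfy
    (1 - z) F(z) = z - z F(z p). Hence their difference D, which is bounded,
    satisfies D(z) = - z / (1 - z) D(z p), and iterating gives D(q) = 0. Finally
    (p;p)_oo = (q;q)_oo (-q;q)_oo. *)

(** * Convergence in the complex numbers *)

Lemma cplx_real_complex (R : realType) (z : Cplx R) :
  z \is Num.real -> z = (complex.Re z)%:C%C.
Proof. by move=> /RRe_real. Qed.

(** The modulus is at most [|Re| + |Im|], so each part gets half of the tolerance. A positive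
    complex [e] is real and can be replaced by its real part. *)
Lemma cplx_cvg (R : realType) (T : Type) (F : set_system T) (FF : Filter F)
    (f : T -> Cplx R) (a b : R) :
  (fun x => complex.Re (f x)) @ F --> a -> (fun x => complex.Im (f x)) @ F --> b ->
  f @ F --> ((a +i* b)%C : Cplx R).
Proof.
move=> fa fb; apply/cvgrPdist_le => e e0.
have eE : e = (complex.Re e)%:C%C by apply/cplx_real_complex/gtr0_real.
have e'0 : 0 < complex.Re e / 2 by rewrite divr_gt0// -ltcR -eE.
near=> x.
have ha : `|a - complex.Re (f x)| <= complex.Re e / 2.
  by near: x; move/cvgrPdist_le: fa; apply.
have hb : `|b - complex.Im (f x)| <= complex.Re e / 2.
  by near: x; move/cvgrPdist_le: fb; apply.
rewrite [leLHS](_ : _ =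
  `|((a - complex.Re (f x)) +i* (b - complex.Im (f x)))%C : R[i]|); last first.
  by case: (f x).
rewrite eE normc_def /= lecR.
apply: (le_trans (y := `|a - complex.Re (f x)| + `|b - complex.Im (f x)|)); last first.
  by rewrite [leRHS]splitr lerD.
rewrite -[leRHS]ger0_norm ?addr_ge0// -[leRHS]sqrtr_sqr ler_wsqrtr//.
by rewrite [leRHS]sqrrD !real_normK ?num_real// lerD2r lerDl mulrn_wge0// mulr_ge0.
Unshelve. all: by end_near. Qed.

(** The order of [K] is only partial; [M] real makes it comparable with [|l|], so that [M < |l|] can
    be refuted near the limit. *)
Lemma cvg_norm_le (K : numFieldType) (T : Type) (F : set_system T) (FF : ProperFilter F)
    (f : T -> K) (l M : K) : M \is Num.real ->
  f @ F --> l -> (forall x, `|f x| <= M) -> `|l| <= M.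
Proof.
move=> MR fl fM; rewrite real_leNgt ?normr_real//; apply/negP => Ml.
have /filter_ex[x] : \forall x \near F, M < `|f x| by exact: cvgr_norm_gt fl _ Ml.
by move=> /lt_le_trans /(_ (fM x)); rewrite ltxx.
Qed.

Lemma partial_sumE (I : choiceType) (V : zmodType) (f : I -> V) (A : {fset I}) :
  partial_sum f A = \sum_(i <- A) f i.
Proof. by rewrite /partial_sum big_seq_fsetE. Qed.

Lemma ge0_partial_sum_subset (I : choiceType) (K : numDomainType) (g : I -> K)
    (A B : {fset I}) :
  (forall i, 0 <= g i) -> (A `<=` B)%fset -> partial_sum g A <= partial_sum g B.
Proof.
move=> g0 AB; rewrite !partial_sumE [leRHS](big_fsetID _ (fun x => x \in A))/=.
rewrite (_ : [fset x in B | x \in A]%fset = A); first by rewrite lerDl sumr_ge0.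
apply/fsetP => x; rewrite !inE /=; case: (boolP (x \in A)); rewrite ?andbF ?andbT//.
by move=> /(fsubsetP AB)->.
Qed.

(** Partial sums grow with the index set, so they converge to their supremum. *)
Lemma ge0_partial_sum_is_cvg (R : realType) (I : choiceType) (g : I -> R) (M : R) :
  (forall i, 0 <= g i) -> (forall A, partial_sum g A <= M) ->
  cvg (partial_sum g @ totally).
Proof.
move=> g0 gM; pose E := range (partial_sum g).
have supE : has_sup E.
  split; first by exists (partial_sum g fset0), fset0.
  by exists M => _ [A _ <-].
apply/cvg_ex; exists (sup E); apply/cvgrPdist_le => e e0.
have [_ [A _ <-] hA] := sup_adherent e0 supE.
exists A => // B /= AB.
have gAB := ge0_partial_sum_subset g0 AB.
have : partial_sum g B <= sup E.
  by move/ubP: (sup_upper_bound supE); apply; exists B.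
rewrite ler_norml; lra.
Qed.

Lemma partial_sum_is_cvg (R : realType) (I : choiceType) (f : I -> Cplx R)
    (g : I -> R) (M : R) :
  (forall i, `|f i| <= (g i)%:C%C) -> (forall A, partial_sum g A <= M) ->
  cvg (partial_sum f @ totally).
Proof.
move=> fg gM.
have g0 i : 0 <= g i by rewrite -lecR; apply: le_trans (fg i); exact: normr_ge0.
have real_cvg (h : I -> R) : (forall i, `|h i| <= g i) -> cvg (partial_sum h @ totally).
  (* [h] is the difference of the nonnegative families [g + h] and [g]. *)
  move=> hg.
  have -> : partial_sum h = partial_sum (fun i => g i + h i) - partial_sum g.
    by apply/funext => A; rewrite !fctE !partial_sumE big_split/= addrAC subrr add0r.
  apply: is_cvgB; last exact: ge0_partial_sum_is_cvg gM.
  apply: (@ge0_partial_sum_is_cvg _ _ _ (M + M)) => [i|A].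
    by move: (hg i); rewrite ler_norml; lra.
  rewrite (le_trans _ (lerD (gM A) (gM A)))// !partial_sumE -big_split/= ler_sum// => i _.
  by move: (hg i); rewrite ler_norml; lra.
have ReIm i : (`|complex.Re (f i)| <= g i) /\ (`|complex.Im (f i)| <= g i).
  split; rewrite -lecR; apply: le_trans (fg i); first exact: normc_ge_Re.
  rewrite normc_def lecR -sqrtr_sqr ler_wsqrtr// lerDr sqr_ge0//.
have [cRe cIm] : cvg (partial_sum (fun i => complex.Re (f i)) @ totally) /\
    cvg (partial_sum (fun i => complex.Im (f i)) @ totally).
  by split; apply: real_cvg => i; case: (ReIm i).
apply/cvg_ex; eexists; apply: cplx_cvg.
- rewrite (_ : (fun A => _) = partial_sum (fun i => complex.Re (f i))); first exact: cRe.
  by apply/funext => A; rewrite !partial_sumE (raddf_sum (@complex.Re R : Rcomplex R -> R)).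
- rewrite (_ : (fun A => _) = partial_sum (fun i => complex.Im (f i))); first exact: cIm.
  by apply/funext => A; rewrite !partial_sumE (raddf_sum (@complex.Im R : Rcomplex R -> R)).
Qed.

Lemma series_geometric_is_cvg (R : realType) (u : nat -> Cplx R) (M r : R) :
  0 <= r < 1 -> (forall n, `|u n| <= (M * r ^+ n)%:C%C) -> cvgn (series u).
Proof.
move=> /andP[r0 r1] uM.
have nr1 : `|r| < 1 by rewrite ger0_norm.
have real_cvg (h : nat -> R) : (forall i, `|h i| <= M * r ^+ i) -> cvgn (series h).
  move=> hM; apply: normed_cvg => /=.
  apply: (@series_le_cvg _ _ (geometric M r)) => //.
  - by move=> n; exact: normr_ge0.
  - by move=> n /=; apply: le_trans (hM n); exact: normr_ge0.
  - exact: is_cvg_geometric_series.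
have [cRe cIm] : cvgn (series (fun i => complex.Re (u i))) /\
    cvgn (series (fun i => complex.Im (u i))).
  split; apply: real_cvg => i; rewrite -lecR; apply: le_trans (uM i); first exact: normc_ge_Re.
  rewrite normc_def lecR -sqrtr_sqr ler_wsqrtr// lerDr sqr_ge0//.
apply/cvg_ex; eexists; apply: cplx_cvg.
- rewrite (_ : (fun A => _) = series (fun i => complex.Re (u i))); first exact: cRe.
  by apply/funext => A; rewrite !seriesEnat (raddf_sum (@complex.Re R : Rcomplex R -> R)).
- rewrite (_ : (fun A => _) = series (fun i => complex.Im (u i))); first exact: cIm.
  by apply/funext => A; rewrite !seriesEnat (raddf_sum (@complex.Im R : Rcomplex R -> R)).
Qed.

(** An unordered sum can be computed as an iterated limit, first in [M], then in [N]: if every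
    superset of [B] gives a sum within [e] of [l], this closed bound survives the inner limit. *)
Lemma cvg_partial_sum_exhaustion (K : numFieldType) (I : choiceType) (f : I -> K)
    (A : nat -> nat -> {fset I}) (g : nat -> K) (l : K) :
  (forall B : {fset I}, \forall N \near \oo, \forall M \near \oo, (B `<=` A N M)%fset) ->
  (forall N, partial_sum f (A N M) @[M --> \oo] --> g N) ->
  partial_sum f @ totally --> l -> g @ \oo --> l.
Proof.
move=> Aexh fg /cvgrPdist_le fl; apply/cvgrPdist_le => e e0.
have [B _ hB] := fl e e0; near=> N.
have /filter_ex[M0 _] : \forall M \near \oo, (B `<=` A N M)%fset by near: N.
have [M1 _ hM1] : \forall M \near \oo, (B `<=` A N M)%fset by near: N; exact: Aexh.
(* Shifting by [M1] makes the bound valid for every index, as [cvg_norm_le] demands. *)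
apply: (@cvg_norm_le _ _ \oo _ (fun M => l - partial_sum f (A N (M + M1)%N))).
- exact: gtr0_real.
- by apply: cvgB; [exact: cvg_cst|rewrite (cvg_shiftn M1 (fun M => partial_sum f (A N M)))].
- by move=> M; apply: hB; apply: hM1; rewrite /= leq_addl.
Unshelve. all: by end_near. Qed.

(** * Enumeration of the elements with bounded parts and multiplicities *)

Definition list_weight (s : seq part) : nat := sumn (map psize s).

Definition positive_parts (s : seq part) : bool := all (fun x => 0 < psize x)%N s.

(* [gon_rel x y] says that y may occur somewhere after x in an element of G_O^N. *)
Definition gon_rel (x y : part) : bool :=
  if overlined x then overlined y && (psize y < psize x)%N
  else (psize y + overlined y <= psize x)%N.

(** Membership becomes a condition on ordered pairs, suited to induction on the list. The G_O^N
    condition is tested in both orders: with non-increasing sizes it forbids a non-overlined part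
    after an overlined one, and it makes an overlined part strictly smaller than any non-overlined
    part before it. *)
Lemma gon_relP (s : seq part) :
  is_overpartition s &&
    all (fun x => all (fun y =>
      ~~ overlined x && overlined y ==> (psize y < psize x)%N) s) s =
  positive_parts s && pairwise gon_rel s.
Proof.
elim: s => [//|a s IH] /=.
set Q := fun x y : part => ~~ overlined x && overlined y ==> (psize y < psize x)%N.
have Qaa : Q a a by rewrite /Q andNb.
have opE : is_overpartition (a :: s) = [&& (0 < psize a)%N,
    all (fun y => (psize y <= psize a)%N && (overlined y ==> (psize a != psize y))) s
    & is_overpartition s].
  rewrite /is_overpartition /= path_sortedE; last by move=> x y z /= xy yz; exact: leq_trans yz xy.
  rewrite all_map all_predI.
  move: (0 < psize a)%N (all _ s) (all _ s) (all _ s) (pairwise _ s) (sorted _ _).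
  by move=> [] [] [] [] [] [].
have condE : all (fun x => all (Q x) (a :: s)) (a :: s) =
    [&& all (Q a) s, all (fun x => Q x a) s & all (fun x => all (Q x) s) s].
  rewrite /= Qaa /=; congr (_ && _).
  by rewrite -all_predI; apply: eq_all.
transitivity (is_overpartition (a :: s) && all (fun x => all (Q x) (a :: s)) (a :: s)) => //.
rewrite condE opE.
transitivity [&& (0 < psize a)%N, all (gon_rel a) s
  & is_overpartition s && all (fun x => all (Q x) s) s].
  have -> : all (gon_rel a) s = [&&
      all (fun y => (psize y <= psize a)%N && (overlined y ==> (psize a != psize y))) s,
      all (Q a) s & all (fun x => Q x a) s].
    rewrite -!all_predI; apply: eq_all => y /=; rewrite /gon_rel /Q.
    by case: (overlined a); case: (overlined y) => /=;
      rewrite ?addn0 ?addn1 ?andbT ?andbF //; case: ltngtP.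
  have andb_shuffle (b1 b2 b3 b4 b5 b6 : bool) :
    [&& [&& b1, b2 & b3], b4, b5 & b6] = [&& b1, [&& b2, b4 & b5], b3 & b6].
    by case: b1; case: b2; case: b3; case: b4; case: b5; case: b6.
  exact: andb_shuffle.
rewrite IH /positive_parts /=.
by rewrite -andbA; congr (_ && _); rewrite andbCA.
Qed.

Fixpoint distinct_lists (N : nat) : seq (seq part) :=
  if N is n.+1 then distinct_lists n ++ map (cons (n.+1, true)) (distinct_lists n)
  else [:: [::]].

(* Elements with parts at most N and multiplicities of non-overlined parts at
   most M; each iteration adds one more copy of the largest part, possibly the
   first one, in front of overlined parts only. *)
Fixpoint gon_lists (M N : nat) : seq (seq part) :=
  if N is n.+1 then
    iter M (fun Y => gon_lists M n ++ map (cons (n.+1, false)) (Y ++ distinct_lists n))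
      (gon_lists M n)
  else [::].

Definition distinct_list (N : nat) (s : seq part) : bool :=
  [&& all overlined s, positive_parts s, pairwise gon_rel s
    & all (fun y => psize y <= N)%N s].

(** The bound on sizes is stated as if a part [(N, false)] stood in front: non-overlined parts are
    at most [N], and overlined ones, lying below some non-overlined part, are less than [N]. *)
Definition gon_list (N : nat) (s : seq part) : bool :=
  [&& has (fun x => ~~ overlined x) s, positive_parts s, pairwise gon_rel s
    & all (gon_rel (N, false)) s].

Lemma mem_distinct_lists (N : nat) (s : seq part) :
  (s \in distinct_lists N) = distinct_list N s.
Proof.
rewrite /distinct_list; elim: N s => [|N IH] s /=.
  case: s => [|[a b] s]//=; rewrite in_cons in_nil orbF.
  by case: a => [|a]; rewrite /= ?andbF.
rewrite mem_cat IH; apply/idP/idP => [/orP[|/mapP[t]]|].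
- move=> /and4P[-> -> -> /= hs]; apply: sub_all hs => y; exact: leqW.
- rewrite IH => /and4P[h1 h2 h3 h4] -> /=.
  rewrite h1 h2 h3 /= leqnn /=; apply/andP; split; last by apply: sub_all h4 => y; exact: leqW.
  rewrite /gon_rel /=; have := h1; have := h4; rewrite andbT => h4' h1'.
  by rewrite all_predI h1'.
- case: s => [//|[a b] s] /and4P[/= /andP[hb h1] h2 /andP[h3 h4] /andP[h5 h6]].
  have hs : all (fun y => psize y < a)%N s.
    by move: h3; rewrite /gon_rel /= hb all_predI => /andP[].
  case: (eqVneq a N.+1) h2 hs h3 h5 => [->|aN] h2 hs h3 h5.
    apply/orP; right; apply/mapP; exists s; last by rewrite hb.
    by rewrite IH h1 h4 andbC /= -andbA; case/andP: h2 => _ ->; rewrite andbT.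
  have aN' : (a <= N)%N by move: aN h5; rewrite /psize/=; lia.
  apply/orP; left; apply/and4P; split=> //=; [exact/andP|exact/andP|].
  by rewrite aN'; apply: sub_all hs => y; rewrite /psize; lia.
Qed.

Lemma gon_listS (N : nat) (s : seq part) : gon_list N s -> gon_list N.+1 s.
Proof.
move=> /and4P[h1 h2 h3 h4]; apply/and4P; split=> //.
by apply: sub_all h4 => y; rewrite /gon_rel/=; lia.
Qed.

Lemma gon_list_cons (N : nat) (s : seq part) :
  gon_list N.+1 s || distinct_list N s -> gon_list N.+1 ((N.+1, false) :: s).
Proof.
move=> /orP[/and4P[h1 h2 h3 h4]|/and4P[h1 h2 h3 h4]]; apply/and4P; split=> //=.
- by rewrite h4 h3.
- by rewrite /gon_rel/= addn0 leqnn /=.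
- rewrite h3 andbT; apply: sub_all h4 => y; rewrite /gon_rel/=.
  by case: (overlined y); lia.
- rewrite {1}/gon_rel/= addn0 leqnn /=; apply: sub_all h4 => y; rewrite /gon_rel/=.
  by case: (overlined y); lia.
Qed.

Lemma gon_lists_sound (M N : nat) : all (gon_list N) (gon_lists M N).
Proof.
elim: N => [//|N IH] /=.
have IH' : all (gon_list N.+1) (gon_lists M N) by apply: sub_all IH; exact: gon_listS.
(* Only the iteration count is generalised; the [M] inside [gon_lists M N] stays fixed. *)
elim: {1}M => [//|k IHk] /=; rewrite all_cat IH' /= all_map.
apply/allP => s; rewrite mem_cat mem_distinct_lists => hs /=; apply: gon_list_cons.
by case/orP: hs => [/(allP IHk)->//|->]; rewrite orbT.
Qed.

(** The length of a list bounds all its multiplicities, so it can serve as the bound for [M]. *)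
Lemma gon_lists_complete (M N : nat) (s : seq part) :
  gon_list N s -> (size s <= M)%N -> s \in gon_lists M N.
Proof.
elim: N s => [|N IH] s.
  move=> /and4P[/hasP[[a b] xs xb] /allP/(_ _ xs) xpos _ /allP/(_ _ xs)].
  by rewrite /gon_rel/=; move: xpos; rewrite /psize/=; lia.
move=> sN sM /=.
(* Each removed copy of the largest part lowers both the length and [k]; [k <= M] keeps the lists
   without that part within reach of the induction hypothesis on [N]. *)
suff iterP : forall k t, gon_list N.+1 t -> (size t <= k <= M)%N ->
    t \in iter k (fun Y => gon_lists M N ++
      map (cons (N.+1, false)) (Y ++ distinct_lists N)) (gon_lists M N).
  by apply: iterP; rewrite // sM leqnn.
elim=> [|k IHk] {sN sM} [|[a b] {}s] //= /and4P[h1 h2 h34 h56] /andP[sk kM].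
move: h34 h56.
rewrite [pairwise _ _]/= => /andP[h3 h4]; rewrite [all _ _]/= => /andP[h5 h6].
rewrite mem_cat; have [abN|abN] := eqVneq (a, b) (N.+1, false).
  apply/orP; right; rewrite abN; apply: map_f; rewrite mem_cat mem_distinct_lists.
  move: h2; rewrite /positive_parts /= => /andP[_ h2].
  case: (boolP (has (fun x => ~~ overlined x) s)) => hs.
    apply/orP; left; apply: IHk; last by rewrite -ltnS sk ltnW.
    by apply/and4P; split.
  apply/orP; right; rewrite -all_predC in hs.
  have hs' : all overlined s by apply: sub_all hs => y /=; rewrite negbK.
  rewrite /distinct_list hs' /positive_parts h2 h4 /=.
  apply/allP => y ys; move/allP/(_ _ ys): h6; move/allP/(_ _ ys): hs'.
  by rewrite /gon_rel/= => ->; lia.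
apply/orP; left; apply: IH; last exact: leq_trans sk kM.
apply/and4P; split => //; first by rewrite /= h3.
(* The head cannot be overlined, since a non-overlined part would have to follow it. Being different
   from [(N.+1, false)], it then has size at most [N]. *)
case: b abN h1 h2 h3 h5 => abN h1 h2 h3 h5.
  move: h1 => /= /hasP[x xs xb]; move/allP/(_ _ xs): h3.
  by rewrite /gon_rel/= (negbTE xb).
have aN : (a <= N)%N.
  by move: h5 abN; rewrite /gon_rel/= /psize/= addn0 xpair_eqE eqxx andbT; lia.
rewrite /= {1}/gon_rel/= addn0 aN /=; apply: sub_all h3 => y; rewrite /gon_rel/=.
by move=> /leq_trans; apply.
Qed.

Lemma uniq_distinct_lists (N : nat) : uniq (distinct_lists N).
Proof.
elim: N => [//|N IH] /=; rewrite cat_uniq IH map_inj_uniq ?IH ?andbT/=; last by move=> ? ? [].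
apply/hasPn => _ /mapP[s _ ->]; rewrite mem_distinct_lists /distinct_list /=.
by rewrite ltnn /= !andbF.
Qed.

(** The pieces are disjoint: a list headed by [(N.+1, false)] exceeds the bound [N], and the tails
    from [distinct_lists] have no non-overlined part, whereas those from [Y] have one. Hence
    soundness is carried along in the induction. *)
Lemma uniq_gon_lists (M N : nat) : uniq (gon_lists M N).
Proof.
elim: N => [//|N IH] /=.
suff: forall k, let Y := iter k (fun Y => gon_lists M N ++
   map (cons (N.+1, false)) (Y ++ distinct_lists N)) (gon_lists M N) in
   all (gon_list N.+1) Y && uniq Y by move=> /(_ M) /andP[].
have hX : all (gon_list N.+1) (gon_lists M N).
  by apply: sub_all (gon_lists_sound M N); exact: gon_listS.
elim=> [|k] /=; first by rewrite hX IH.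
set Y := iter k _ _ => /andP[Yg Yu]; rewrite all_cat hX /= cat_uniq IH /=.
rewrite map_inj_uniq; last by move=> ? ? [].
apply/and3P; split.
- rewrite all_map; apply/allP => s; rewrite mem_cat mem_distinct_lists => hs /=.
  by apply: gon_list_cons; case/orP: hs => [/(allP Yg)->//|->]; rewrite orbT.
- apply/hasPn => _ /mapP[s _ ->]; apply/negP => /(allP (gon_lists_sound M N)).
  by move=> /and4P[_ _ _ /=]; rewrite /gon_rel /= addn0 ltnn.
- rewrite cat_uniq Yu uniq_distinct_lists andbT /=; apply/hasPn => s.
  rewrite mem_distinct_lists => /and4P[so _ _ _]; apply/negP => /(allP Yg)/and4P[/hasP[x xs]].
  by rewrite (allP so).
Qed.

(** * Passage between enumerated lists and elements of G_O^N *)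

Lemma gon_listP (s : seq part) (N : nat) : gon_list N s ->
  exists p : GON, val (val p) = s.
Proof.
move=> /and4P[h1 h2 h3 _].
have /andP[sop scond] : is_overpartition s && all (fun x => all (fun y =>
      ~~ overlined x && overlined y ==> (psize y < psize x)%N) s) s.
  by rewrite gon_relP h2 h3.
have sg : in_GON (Sub s sop : overpartition) by rewrite /in_GON /= h1.
by exists (Sub (Sub s sop : overpartition) sg).
Qed.

(** Every size is at most the weight; strictness leaves room for the extra 1 that [gon_rel] charges
    to overlined parts. *)
Lemma gon_list_val (p : GON) (N : nat) :
  (weight (val p) < N)%N -> gon_list N (val (val p)).
Proof.
move=> pN; have /andP[h1 h2] := valP p; have h3 := valP (val p).
have := gon_relP (val (val p)); rewrite h3 [all _ _]h2 => /esym/andP[h4 h5].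
apply/and4P; split => //; apply/allP => y ys; rewrite /gon_rel/=.
have : (psize y <= weight (val p))%N.
  move: ys; rewrite /weight; elim: (val (val p)) => [//|a s IH] /=.
  by rewrite in_cons => /orP[/eqP->|/IH]; lia.
by move: pN; rewrite /psize /=; case: (overlined y); lia.
Qed.

Lemma gon_lists_enum (M N : nat) :
  exists t : seq GON, map (fun p : GON => val (val p)) t = gon_lists M N.
Proof.
elim: (gon_lists M N) (gon_lists_sound M N) => [_|s L IH] /=; first by exists [::].
move=> /andP[/gon_listP[p <-] /IH[t <-]]; by exists (p :: t).
Qed.

(** * Generating functions of the enumerations *)

Lemma sum_map_cons (K : nzRingType) (q : K) (a : part) (L : seq (seq part)) :
  \sum_(s <- map (cons a) L) q ^+ list_weight s =
  q ^+ psize a * \sum_(s <- L) q ^+ list_weight s.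
Proof. by rewrite big_map mulr_sumr; apply: eq_bigr => s _; rewrite -exprD. Qed.

Lemma distinct_lists_gf (K : comNzRingType) (q : K) (N : nat) :
  \sum_(s <- distinct_lists N) q ^+ list_weight s = qpoch (- q) q N.
Proof.
elim: N => [|N IH] /=; first by rewrite big_seq1 /qpoch big_geq.
rewrite big_cat /= sum_map_cons IH /qpoch big_nat_recr//= /psize/= exprS; ring.
Qed.

(** The part [N.+1] is used [j] times: [0 <= j <= M] in front of a list that has smaller
    non-overlined parts, but [1 <= j <= M] in front of overlined parts only, whence the shorter sum
    and the extra factor [q ^+ N.+1]. *)
Lemma gon_lists_gfS (K : comNzRingType) (q : K) (M N : nat) :
  \sum_(s <- gon_lists M N.+1) q ^+ list_weight s =
  (\sum_(0 <= j < M.+1) (q ^+ N.+1) ^+ j) * (\sum_(s <- gon_lists M N) q ^+ list_weight s) +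
  (\sum_(0 <= j < M) (q ^+ N.+1) ^+ j) * (q ^+ N.+1 * qpoch (- q) q N).
Proof.
rewrite /=; set F := fun Y => _ ++ _; set L := gon_lists M N.
set X := \sum_(s <- L) _; set x := q ^+ N.+1.
have geomS n : \sum_(0 <= j < n.+1) x ^+ j = 1 + x * \sum_(0 <= j < n) x ^+ j.
  by rewrite big_nat_recl//= expr0 mulr_sumr; congr (_ + _); apply: eq_bigr => j _; rewrite exprS.
suff iterE k : \sum_(s <- iter k F L) q ^+ list_weight s =
    (\sum_(0 <= j < k.+1) x ^+ j) * X +
    (\sum_(0 <= j < k) x ^+ j) * (x * qpoch (- q) q N) by [].
elim: k => [|k IH] /=; first by rewrite big_nat1 big_geq// expr0 mul1r mul0r addr0.
rewrite big_cat /= -/X sum_map_cons big_cat /= IH distinct_lists_gf -/x.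
rewrite (geomS k.+1) [X in _ = _ + X * _](geomS k); ring.
Qed.

(** * Finite q-Pochhammer symbols *)

Lemma sum_geometric_le (R : realFieldType) (r : R) (n : nat) :
  0 <= r < 1 -> \sum_(0 <= i < n) r ^+ i <= (1 - r)^-1.
Proof.
move=> /andP[r0 r1]; rewrite -[leRHS]mul1r ler_pdivlMr ?subr_gt0//.
have -> : (\sum_(0 <= i < n) r ^+ i) * (1 - r) = 1 - r ^+ n.
  rewrite mulr_suml (eq_bigr (fun i => - r ^+ i.+1 - - r ^+ i)); last first.
    by move=> i _; rewrite exprS; ring.
  by rewrite telescope_sumr// expr0; ring.
by rewrite gerBl exprn_ge0.
Qed.

Lemma prod_one_plus_le (R : realType) (r : R) (n : nat) : 0 <= r < 1 ->
  \prod_(0 <= i < n) (1 + r ^+ i) <= expR (1 - r)^-1.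
Proof.
move=> r01; have r0 : 0 <= r by case/andP: r01.
apply: (@le_trans _ _ (expR (\sum_(0 <= i < n) r ^+ i))).
  rewrite expR_sum; apply: ler_prod => i _.
  by rewrite expR_ge1Dx andbT addr_ge0 ?exprn_ge0.
by rewrite ler_expR; exact: sum_geometric_le.
Qed.

(** For [0 <= x <= r], [(1 - x) * (1 + x / (1 - r)) >= 1], hence [1 - x >= expR (- (x / (1 - r)))].
    Summing [x = r ^+ i.+1] gives another factor [(1 - r)^-1] in the exponent. *)
Lemma prod_one_minus_ge (R : realType) (r : R) (n : nat) : 0 <= r < 1 ->
  expR (- (1 - r)^-1 ^+ 2) <= \prod_(0 <= i < n) (1 - r ^+ i.+1).
Proof.
move=> r01; have /andP[r0 r1] := r01.
have r1' : 0 < 1 - r by rewrite subr_gt0.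
have rlt i : r ^+ i.+1 <= r by rewrite exprS ler_piMr// exprn_ile1// ltW.
apply: (@le_trans _ _ (expR (\sum_(0 <= i < n) - (r ^+ i.+1 / (1 - r))))).
  rewrite ler_expR sumrN lerN2 -mulr_suml expr2 ler_pM2r ?invr_gt0//.
  apply: le_trans (sum_geometric_le n r01); apply: ler_sum => i _.
  by rewrite exprS ler_piMl ?exprn_ge0// ltW.
rewrite expR_sum; apply: ler_prod => i _; rewrite expR_ge0/= expRN.
have x0 : 0 <= r ^+ i.+1 by rewrite exprn_ge0.
have := rlt i; move: (r ^+ i.+1) x0 => x x0 xr.
have y0 : 0 <= x / (1 - r) by rewrite divr_ge0// ltW.
rewrite -[leLHS]mul1r ler_pdivrMr ?expR_gt0//.
apply: (@le_trans _ _ ((1 - x) * (1 + x / (1 - r)))).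
  have -> : (1 - x) * (1 + x / (1 - r)) = 1 + x * (r - x) / (1 - r).
    by field; rewrite gt_eqF.
  by rewrite lerDl divr_ge0 ?mulr_ge0 ?subr_ge0// ltW.
by rewrite ler_wpM2l ?expR_ge1Dx// subr_ge0; lra.
Qed.

Lemma qpochS (K : pzRingType) (a q : K) (n : nat) :
  qpoch a q n.+1 = qpoch a q n * (1 - a * q ^+ n).
Proof. by rewrite /qpoch big_nat_recr. Qed.

Lemma qpoch0 (K : pzRingType) (a q : K) : qpoch a q 0 = 1.
Proof. by rewrite /qpoch big_geq. Qed.

Lemma qpoch_sqr (K : comPzRingType) (q : K) (n : nat) :
  qpoch (q ^+ 2) (q ^+ 2) n = qpoch q q n * qpoch (- q) q n.
Proof.
elim: n => [|n IH]; first by rewrite !qpoch0 mulr1.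
by rewrite !qpochS IH -exprM mulnC exprM; ring.
Qed.

(** * Uniform bounds and convergence of complex q-Pochhammer symbols *)

Section complex_qpoch.
Context {R : realType}.
Local Notation C := (Cplx R).
Implicit Types (a z : C) (r : R).

Definition qpoch_ub (r : R) : R := expR (1 - r)^-1.
Definition qpoch_lb (r : R) : R := expR (- (1 - r)^-1 ^+ 2).

Lemma qpoch_norm_le r a z n : 0 <= r < 1 -> `|a| <= 1 -> `|z| <= r%:C%C ->
  `|qpoch a z n| <= (qpoch_ub r)%:C%C.
Proof.
move=> r01 a1 zr; have r0 : 0 <= r by case/andP: r01.
apply: (@le_trans _ _ (\prod_(0 <= i < n) (1 + r ^+ i))%:C%C); last first.
  by rewrite lecR; exact: prod_one_plus_le.
rewrite rmorph_prod /qpoch normr_prod; apply: ler_prod => i _.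
rewrite normr_ge0/= rmorphD rmorph1 rmorphXn (le_trans (ler_normB _ _))// normr1 lerD2l.
rewrite normrM normrX -[leRHS]mul1r ler_pM// ?exprn_ge0// lerXn2r// nnegrE//.
by rewrite ler0c.
Qed.

(** With [|a| <= r] the factor of index [i] has modulus at least [1 - r ^+ i.+1], so even the factor
    of index 0 stays away from 0. *)
Lemma qpoch_norm_ge r a z n : 0 <= r < 1 -> `|a| <= r%:C%C -> `|z| <= r%:C%C ->
  (qpoch_lb r)%:C%C <= `|qpoch a z n|.
Proof.
move=> r01 ar zr; have /andP[r0 r1] := r01.
apply: (@le_trans _ _ (\prod_(0 <= i < n) (1 - r ^+ i.+1))%:C%C).
  by rewrite lecR; exact: prod_one_minus_ge.
rewrite rmorph_prod /qpoch normr_prod; apply: ler_prod => i _.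
rewrite ler0c subr_ge0 exprn_ile1 ?(ltW r1)//= rmorphB rmorph1 rmorphXn.
apply: le_trans (lerB_dist _ _); rewrite normr1 lerD2l lerN2 normrM normrX exprS.
by rewrite ler_pM// ?exprn_ge0// lerXn2r// nnegrE// ler0c.
Qed.

Lemma qpoch_lb_gt0 r : 0 < qpoch_lb r. Proof. exact: expR_gt0. Qed.

Lemma qpoch_neq0 r a z n : 0 <= r < 1 -> `|a| <= r%:C%C -> `|z| <= r%:C%C ->
  qpoch a z n != 0.
Proof.
move=> r01 ar zr; rewrite -normr_gt0 (lt_le_trans _ (qpoch_norm_ge n r01 ar zr))//.
by rewrite ltcR qpoch_lb_gt0.
Qed.

Lemma qpoch_is_cvg r a z : 0 <= r < 1 -> `|a| <= 1 -> `|z| <= r%:C%C ->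
  cvgn (qpoch a z).
Proof.
move=> r01 a1 zr; have r0 : 0 <= r by case/andP: r01.
(* Telescoping: the terms are the differences of consecutive products, dominated by a geometric
   sequence because the products are bounded. *)
have -> : qpoch a z = cst 1 + series (fun n => - (qpoch a z n * (a * z ^+ n))).
  apply/funext; elim=> [|n IH].
    by rewrite !fctE seriesEnat /= big_geq// qpoch0 addr0.
  by rewrite qpochS !fctE seriesSr addrA -[_ + series _ _]/((cst 1 + series _) n) -IH; ring.
apply: is_cvgD; first exact: is_cvg_cst.
apply: (@series_geometric_is_cvg _ _ (qpoch_ub r) r) => // n.
rewrite normrN normrM rmorphM rmorphXn ler_pM ?qpoch_norm_le//.
rewrite normrM normrX -[leRHS]mul1r ler_pM// ?exprn_ge0// lerXn2r// nnegrE//.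
by rewrite ler0c.
Qed.

Lemma qpoch_inf_neq0 r a z : 0 <= r < 1 -> `|a| <= r%:C%C -> `|z| <= r%:C%C ->
  qpoch_inf a z != 0.
Proof.
move=> r01 ar zr; apply/eqP => l0.
have a1 : `|a| <= 1 by rewrite (le_trans ar)// -(rmorph1 (real_complex R)) lecR ltW; case/andP: r01.
have cl : qpoch a z @ \oo --> (0 : C) by rewrite -l0; exact: qpoch_is_cvg r01 a1 zr.
have lb0 : 0 < (qpoch_lb r)%:C%C :> C by rewrite ltcR qpoch_lb_gt0.
have /filter_ex[n] : \forall n \near \oo, `|qpoch a z n| < (qpoch_lb r)%:C%C.
  by apply: (cvgr_norm_lt _ cl); rewrite normr0.
by move=> /lt_le_trans /(_ (qpoch_norm_ge n r01 ar zr)); rewrite ltxx.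
Qed.

End complex_qpoch.

(** * The generating function *)

(** Closed form of the generating function with parts at most [N] and unbounded multiplicities. *)
Definition gon_partial_gf (K : unitRingType) (q : K) (N : nat) : K :=
  (qpoch q q N)^-1 * \sum_(0 <= n < N) q ^+ n.+1 * qpoch (q ^+ 2) (q ^+ 2) n.

(** This is [gon_lists_gfS] with full geometric series. By [qpoch_sqr], dividing the new summand by
    [qpoch q q N.+1] leaves [q ^+ N.+1 * qpoch (- q) q N / (1 - q ^+ N.+1)]. *)
Lemma gon_partial_gfS (K : fieldType) (q : K) (N : nat) :
  qpoch q q N.+1 != 0 ->
  gon_partial_gf q N.+1 =
  (1 - q ^+ N.+1)^-1 * gon_partial_gf q N +
  (1 - q ^+ N.+1)^-1 * (q ^+ N.+1 * qpoch (- q) q N).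
Proof.
rewrite /gon_partial_gf big_nat_recr//= qpoch_sqr qpochS -exprS mulf_eq0 negb_or.
by move=> /andP[P0 q0]; field; apply/andP.
Qed.

Lemma gon_lists_gf_le (R : realFieldType) (r : R) (M N : nat) : 0 <= r < 1 ->
  \sum_(s <- gon_lists M N) r ^+ list_weight s <= gon_partial_gf r N.
Proof.
move=> /andP[r0 r1]; have x1 n : 0 < 1 - r ^+ n.+1 by rewrite subr_gt0 exprn_ilt1.
have P0 n : 0 < qpoch r r n.
  by elim: n => [|n IH]; rewrite ?qpoch0// qpochS mulr_gt0// -exprS.
have Q0 n : 0 <= qpoch (- r) r n.
  elim: n => [|n IH]; rewrite ?qpoch0// qpochS mulr_ge0// mulNr opprK.
  by rewrite addr_ge0// mulr_ge0// exprn_ge0.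
elim: N => [|N IH]; first by rewrite /gon_partial_gf /= big_nil big_geq// mulr0.
rewrite gon_lists_gfS gon_partial_gfS ?gt_eqF//.
have geom_le n : \sum_(0 <= j < n) (r ^+ N.+1) ^+ j <= (1 - r ^+ N.+1)^-1.
  by apply: sum_geometric_le; rewrite exprn_ge0//= -subr_gt0.
have geom_ge0 n : 0 <= \sum_(0 <= j < n) (r ^+ N.+1) ^+ j.
  by rewrite sumr_ge0// => j _; rewrite !exprn_ge0.
rewrite lerD// ler_pM// ?sumr_ge0// => [s _|]; first by rewrite exprn_ge0.
by rewrite mulr_ge0// exprn_ge0.
Qed.

(** The bound is uniform in [N], which yields absolute summability over G_O^N. *)
Lemma gon_partial_gf_le (R : realType) (r : R) (N : nat) : 0 <= r < 1 ->
  gon_partial_gf r N <= (qpoch_lb r)^-1 * (1 - r)^-1.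
Proof.
move=> r01; have /andP[r0 r1] := r01.
have T01 n : 0 <= qpoch (r ^+ 2) (r ^+ 2) n <= 1.
  have F01 i : 0 <= 1 - r ^+ 2 * (r ^+ 2) ^+ i <= 1.
    by rewrite -exprS -exprM subr_ge0 gerBl exprn_ge0 ?exprn_ile1// ltW.
  by rewrite /qpoch prodr_ge0 ?prodr_ile1// => i _; case/andP: (F01 i).
have lb : qpoch_lb r <= qpoch r r N.
  rewrite /qpoch; under eq_bigr do rewrite -exprS; exact: prod_one_minus_ge.
have lb0 := qpoch_lb_gt0 r.
rewrite /gon_partial_gf ler_pM//.
- by rewrite invr_ge0 (le_trans (ltW lb0)).
- by rewrite sumr_ge0// => n _; rewrite mulr_ge0 ?exprn_ge0//; case/andP: (T01 n).
- by rewrite lef_pV2// posrE (lt_le_trans lb0).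
- apply: le_trans (sum_geometric_le N r01); apply: ler_sum => n _.
  rewrite -[leRHS]mulr1 ler_pM ?exprn_ge0//; try by case/andP: (T01 n).
  by rewrite exprS ler_piMl ?exprn_ge0// ltW.
Qed.

Lemma gon_lists_fset (M N : nat) :
  exists A : {fset GON}, perm_eq (map (fun p : GON => val (val p)) A) (gon_lists M N).
Proof.
have [t tE] := gon_lists_enum M N; exists [fset p in t]%fset; rewrite -tE.
apply: perm_map; apply: uniq_perm; first exact: fset_uniq.
- by have := uniq_gon_lists M N; rewrite -tE => /map_uniq.
- by move=> p; rewrite inE.
Qed.

Lemma cvg_geometric_sum (K : numFieldType) (x : K) : x != 1 ->
  (fun n => x ^+ n) @ \oo --> (0 : K) ->
  (fun n => \sum_(0 <= j < n) x ^+ j) @ \oo --> (1 - x)^-1.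
Proof.
move=> x1 x0; rewrite (_ : (fun n => _) = series (geometric 1 x)); last first.
  by apply/funext => n; rewrite seriesEnat; apply: eq_bigr => j _ /=; rewrite mul1r.
rewrite geometric_seriesE//.
have : (fun n => 1 * (1 - x ^+ n) / (1 - x)) @ \oo --> 1 * (1 - 0) / (1 - x).
  by apply: cvgMr_tmp; apply: cvgMl_tmp; apply: cvgB => //; exact: cvg_cst.
by rewrite subr0 mulr1 mul1r.
Qed.

Lemma gon_lists_gf_cvg (K : numFieldType) (q : K) (N : nat) :
  (forall n, qpoch q q n != 0) -> (fun n => q ^+ n) @ \oo --> (0 : K) ->
  (fun M => \sum_(s <- gon_lists M N) q ^+ list_weight s) @ \oo --> gon_partial_gf q N.
Proof.
move=> P0 q0; elim: N => [|N IH].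
  have -> : gon_partial_gf q 0 = 0 by rewrite /gon_partial_gf big_geq// mulr0.
  rewrite (_ : (fun M => _) = cst 0); first exact: cvg_cst.
  by apply/funext => M; rewrite /= big_nil.
rewrite gon_partial_gfS//.
under eq_fun do rewrite gon_lists_gfS.
have geomN : (fun M => \sum_(0 <= j < M) (q ^+ N.+1) ^+ j) @ \oo --> (1 - q ^+ N.+1)^-1.
  apply: cvg_geometric_sum.
    by have := P0 N.+1; rewrite qpochS mulf_eq0 -exprS negb_or => /andP[_]; rewrite subr_eq0 eq_sym.
  (* The powers of [q ^+ N.+1] form a product of [N.+1] copies of the null sequence [q ^+ n]. *)
  rewrite (_ : (fun n => _) = (fun n => (q ^+ n) ^+ N.+1)); last first.
    by apply/funext => n; rewrite -!exprM mulnC.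
  elim: N {IH} => [//|N IH]; rewrite -(mulr0 0).
  rewrite (_ : (fun n => _) = (fun n => q ^+ n * (q ^+ n) ^+ N.+1)); last first.
    by apply/funext => n; rewrite exprS.
  exact: cvgM.
apply: cvgD; last exact: cvgMr_tmp.
apply: cvgM => //.
by rewrite (cvg_shiftS (fun M => \sum_(0 <= j < M) (q ^+ N.+1) ^+ j)).
Qed.

(** * Summation over G_O^N for complex [q] *)

Section gon_sum.
Context {R : realType}.
Local Notation C := (Cplx R).
Variables (q : C) (r : R).
Hypotheses (r01 : 0 <= r < 1) (qr : `|q| = r%:C%C).

Let qr_le : `|q| <= r%:C%C. Proof. by rewrite qr. Qed.

Let qpoch_q_neq0 n : qpoch q q n != 0. Proof. exact: (qpoch_neq0 n r01). Qed.

Let expr_cvg0 : (fun n => q ^+ n) @ \oo --> (0 : C).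
Proof.
apply: cvg_series_cvg_0; apply: (@series_geometric_is_cvg _ _ 1 r) => // k.
by rewrite normrX mul1r rmorphXn qr.
Qed.

Lemma partial_sum_GON_is_cvg :
  cvg (partial_sum (fun p : GON => q ^+ weight (val p)) @ totally).
Proof.
have r0 : 0 <= r by case/andP: r01.
apply: (@partial_sum_is_cvg _ _ _ (fun p => r ^+ weight (val p))
  ((qpoch_lb r)^-1 * (1 - r)^-1)) => [p|A]; first by rewrite normrX qr -rmorphXn.
(* Any finite [A] sits inside one enumeration: [M] bounds the numbers of parts, and [N] exceeds all
   weights. *)
pose M := \max_(p <- A) size (val (val p)).
pose N := (\max_(p <- A) weight (val p)).+1.
have [B BE] := gon_lists_fset M N.
have AB : (A `<=` B)%fset.
  apply/fsubsetP => p pA.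
  rewrite -(mem_map (inj_comp val_inj val_inj)) (perm_mem BE).
  apply: gon_lists_complete; last by rewrite /M; exact: leq_bigmax_seq.
  by apply: gon_list_val; rewrite ltnS /N; exact: leq_bigmax_seq.
apply: le_trans (ge0_partial_sum_subset _ AB) _; first by move=> p; rewrite exprn_ge0.
apply: le_trans (gon_partial_gf_le N r01).
apply: le_trans (gon_lists_gf_le M N r01).
rewrite partial_sumE -(perm_big _ BE)/= big_map.
by [].
Qed.

Lemma gon_partial_gf_cvg :
  gon_partial_gf q @ \oo --> summability.sum (fun p : GON => q ^+ weight (val p)).
Proof.
pose A M N := sval (cid (gon_lists_fset M N)).
have AE M N : perm_eq (map (fun p : GON => val (val p)) (A M N)) (gon_lists M N).
  exact: svalP (cid (gon_lists_fset M N)).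
apply: (@cvg_partial_sum_exhaustion _ _ _ (fun N M => A M N)) partial_sum_GON_is_cvg.
- move=> B; exists (\max_(p <- B) weight (val p)).+1 => // N /= hN.
  exists (\max_(p <- B) size (val (val p))) => // M /= hM.
  apply/fsubsetP => p pB.
  rewrite -(mem_map (inj_comp val_inj val_inj)) (perm_mem (AE M N)).
  apply: gon_lists_complete; last by apply: leq_trans hM; exact: leq_bigmax_seq.
  by apply: gon_list_val; apply: leq_trans hN; rewrite ltnS; exact: leq_bigmax_seq.
- move=> N; rewrite (_ : (fun M => _) = (fun M => \sum_(s <- gon_lists M N) q ^+ list_weight s)).
    exact: gon_lists_gf_cvg.
  by apply/funext => M; rewrite partial_sumE -(perm_big _ (AE M N))/= big_map.
Qed.

End gon_sum.

(** * The second identity *)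

(* A(z) and B(z) at z = q^(2j+1), where z p = q^(2(j+1)+1). *)
Definition odd_qseries (K : pzRingType) (q : K) (j : nat) : nat -> K :=
  series (fun n => (q ^+ j.*2.+1) ^+ n.+1 * qpoch (q ^+ 2) (q ^+ 2) n).

Definition odd_lambert (K : unitRingType) (q : K) (j : nat) : nat -> K :=
  series (fun k => q ^+ (j + k).*2.+1 / (1 - q ^+ (j + k).*2.+1) *
                   (qpoch (q ^+ 2) (q ^+ 2) k)^-1).

(** With [z = q ^+ j.*2.+1] and [p = q ^+ 2], the factor [1 - p^n] of [(p;p)_n] splits
    [z^(n+1) (p;p)_n] into [z z^n (p;p)_(n-1) - z (z p)^n (p;p)_(n-1)]; the term [n = 0] gives
    [z]. *)
Lemma odd_qseries_rec (K : comPzRingType) (q : K) (j N : nat) :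
  odd_qseries q j N.+1 =
  q ^+ j.*2.+1 + q ^+ j.*2.+1 * odd_qseries q j N - q ^+ j.*2.+1 * odd_qseries q j.+1 N.
Proof.
rewrite /odd_qseries; elim: N => [|N IH].
  by rewrite !seriesEnat /= big_nat1 !big_geq// qpoch0 expr1; ring.
rewrite !seriesSr in IH *; rewrite [X in X + _ = _]IH qpochS.
have -> : q ^+ j.+1.*2.+1 = q ^+ j.*2.+1 * q ^+ 2 by rewrite -exprD addn2.
rewrite -[q ^+ 2 * (q ^+ 2) ^+ N]exprS [(q ^+ j.*2.+1 * q ^+ 2) ^+ _]exprMn.
rewrite [(q ^+ j.*2.+1) ^+ N.+2]exprS.
move: ((q ^+ 2) ^+ N.+1) ((q ^+ j.*2.+1) ^+ N.+1) (q ^+ j.*2.+1) => x z y.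
by ring.
Qed.

(** In the same notation, [1 / (p;p)_(k-1) = (1 - p^k) / (p;p)_k] and
    [(1 - z) + z (1 - p^k) = 1 - z p^k] cancel the denominators: matching terms add up to
    [z p^k / (p;p)_k], whose sum over [k <= N] is [z / (p;p)_N]. *)
Lemma odd_lambert_rec (K : fieldType) (q : K) (j N : nat) :
  (forall n, qpoch (q ^+ 2) (q ^+ 2) n != 0) ->
  (forall n, 1 - q ^+ n.*2.+1 != 0) ->
  (1 - q ^+ j.*2.+1) * odd_lambert q j N.+1 =
  q ^+ j.*2.+1 / qpoch (q ^+ 2) (q ^+ 2) N - q ^+ j.*2.+1 * odd_lambert q j.+1 N.
Proof.
move=> T0 y0; rewrite /odd_lambert; elim: N => [|N IH].
  rewrite !seriesEnat /= big_nat1 !big_geq// qpoch0 addn0.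
  by have := y0 j; move: (q ^+ _) => y y1; field; rewrite oner_eq0.
rewrite [series _ N.+2]seriesSr mulrDr IH [in RHS]seriesSr.
have := T0 N.+1; have := y0 (j + N.+1)%N; rewrite qpochS -exprS -exprM addSnnS.
have -> : q ^+ (j + N.+1).*2.+1 = q ^+ j.*2.+1 * q ^+ (2 * N.+1).
  by rewrite -exprD; congr (_ ^+ _); lia.
move: (q ^+ j.*2.+1) (q ^+ (2 * N.+1)) (qpoch _ _ N) (series _ N) => y x T S yx.
rewrite mulf_eq0 negb_or => /andP[TN x1]; field; do ?[apply/andP; split] => //.
Qed.

(** * The functional equation in the limit and its iteration *)

Section odd_limits.
Context {K : numFieldType}.
Variables (q : K) (A B : nat -> K) (t : K).
Hypotheses (t0 : t != 0) (T_cvg : qpoch (q ^+ 2) (q ^+ 2) @ \oo --> t).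
Hypothesis A_cvg : forall j, odd_qseries q j @ \oo --> A j.
Hypothesis B_cvg : forall j, odd_lambert q j @ \oo --> B j.
Hypothesis T0 : forall n, qpoch (q ^+ 2) (q ^+ 2) n != 0.
Hypothesis y0 : forall n, 1 - q ^+ n.*2.+1 != 0.

(** Multiplying the limit recurrence of [B] by [t] turns its inhomogeneous term [y / t] into the [y]
    of [A], so the two cancel. *)
Lemma odd_diff_rec (j : nat) :
  (1 - q ^+ j.*2.+1) * (A j - t * B j) = - q ^+ j.*2.+1 * (A j.+1 - t * B j.+1).
Proof.
set y := q ^+ j.*2.+1.
have AE : A j = y + y * A j - y * A j.+1.
  have A1 : (fun N => odd_qseries q j N.+1) @ \oo --> A j by rewrite cvg_shiftS.
  have A2 : (fun N => odd_qseries q j N.+1) @ \oo --> y + y * A j - y * A j.+1.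
    under eq_fun do rewrite odd_qseries_rec.
    apply: cvgB; last exact: cvgMl_tmp.
    by apply: cvgD; [exact: cvg_cst|exact: cvgMl_tmp].
  exact: (cvg_unique _ A1 A2).
have BE : (1 - y) * B j = y / t - y * B j.+1.
  have B1 : (fun N => (1 - y) * odd_lambert q j N.+1) @ \oo --> (1 - y) * B j.
    by apply: cvgMl_tmp; rewrite (cvg_shiftS (odd_lambert q j)).
  have B2 : (fun N => (1 - y) * odd_lambert q j N.+1) @ \oo --> y / t - y * B j.+1.
    under eq_fun do rewrite odd_lambert_rec//.
    apply: cvgB; last exact: cvgMl_tmp.
    by apply: cvgMl_tmp; apply: cvgV.
  exact: (cvg_unique _ B1 B2).
rewrite mulrBr mulrCA BE {1}mulrBl mul1r {1}AE.
by field.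
Qed.

Lemma odd_diff_iter (j : nat) :
  qpoch q (q ^+ 2) j * (A 0%N - t * B 0%N) =
  (\prod_(0 <= i < j) - q ^+ i.*2.+1) * (A j - t * B j).
Proof.
elim: j => [|j IH]; first by rewrite qpoch0 big_geq.
rewrite qpochS mulrAC IH big_nat_recr//= -[RHS]mulrA -odd_diff_rec -exprM -exprS mul2n.
by ring.
Qed.

End odd_limits.

Lemma sum_geometric_norm_le (R : realType) (u : nat -> Cplx R) (M r : R) (N : nat) :
  0 <= r < 1 -> 0 <= M -> (forall n, `|u n| <= (M * r ^+ n)%:C%C) ->
  `|series u N| <= (M / (1 - r))%:C%C.
Proof.
move=> r01 M0 uM; rewrite seriesEnat.
apply: le_trans (ler_norm_sum _ _ _) _.
apply: (@le_trans _ _ (\sum_(0 <= n < N) M * r ^+ n)%:C%C).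
  by rewrite rmorph_sum; apply: ler_sum => n _; exact: uM.
by rewrite lecR -mulr_sumr ler_wpM2l//; exact: sum_geometric_le.
Qed.

Lemma geometric_bound_eq0 (R : realType) (M r x : R) :
  0 <= r < 1 -> (forall n, x <= M * r ^+ n) -> x <= 0.
Proof.
move=> /andP[r0 r1] xM.
have M0 : geometric M r @ \oo --> 0 by apply: cvg_geometric; rewrite ger0_norm.
rewrite -(cvg_lim _ M0)//; apply: limr_ge; first by apply/cvg_ex; exists 0.
by apply: nearW => n; exact: xM.
Qed.

(** * Vanishing of the difference of the two series *)

Section odd_series_identity.
Context {R : realType}.
Local Notation C := (Cplx R).
Variables (q : C) (r : R).
Hypotheses (r01 : 0 <= r < 1) (qr : `|q| = r%:C%C).

Let r0 : 0 <= r. Proof. by case/andP: r01. Qed.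

Let r_le1 : r <= 1. Proof. by case/andP: r01 => _ /ltW. Qed.

Let q_le : `|q| <= r%:C%C. Proof. by rewrite qr. Qed.

Let normqX n : `|q ^+ n| = (r ^+ n)%:C%C.
Proof. by rewrite normrX qr rmorphXn. Qed.

Let q2_le : `|q ^+ 2| <= r%:C%C.
Proof. by rewrite normqX lecR expr2 ler_piMl. Qed.

Let q2_le1 : `|q ^+ 2| <= 1.
Proof. by rewrite (le_trans q2_le)// -(rmorph1 (real_complex R)) lecR. Qed.

Let T_neq0 n : qpoch (q ^+ 2) (q ^+ 2) n != 0.
Proof. exact: (qpoch_neq0 n r01). Qed.

Let one_minus_ge n : (1 - r)%:C%C <= `|1 - q ^+ n.*2.+1|.
Proof.
apply: le_trans (lerB_dist _ _); rewrite normr1 normqX rmorphB rmorph1 lerD2l lerN2 lecR.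
by rewrite exprS ler_piMr// exprn_ile1.
Qed.

Let one_minus_neq0 n : 1 - q ^+ n.*2.+1 != 0.
Proof.
rewrite -normr_gt0 (lt_le_trans _ (one_minus_ge n))// ltcR subr_gt0.
by case/andP: r01.
Qed.

(** Independence of [j] matters: the limits for all [j] are then bounded by one constant. *)
Let odd_qseries_term_le j n :
  `|(q ^+ j.*2.+1) ^+ n.+1 * qpoch (q ^+ 2) (q ^+ 2) n| <= (qpoch_ub r * r ^+ n)%:C%C.
Proof.
rewrite normrM mulrC rmorphM ler_pM ?qpoch_norm_le// -exprM normqX lecR.
by rewrite ler_wiXn2l//; lia.
Qed.

Let odd_lambert_term_le j k :
  `|q ^+ (j + k).*2.+1 / (1 - q ^+ (j + k).*2.+1) * (qpoch (q ^+ 2) (q ^+ 2) k)^-1|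
  <= ((qpoch_lb r)^-1 * (1 - r)^-1 * r ^+ k)%:C%C.
Proof.
have r1 : 0 < 1 - r by rewrite subr_gt0; case/andP: r01.
have rC1 : 0 < (1 - r)%:C%C :> C by rewrite ltcR.
have lbC : 0 < (qpoch_lb r)%:C%C :> C by rewrite ltcR qpoch_lb_gt0.
rewrite !normrM mulrC !rmorphM -mulrA normfV (mulrC `|q ^+ _|).
rewrite !fmorphV !normfV; apply: ler_pM; [by rewrite invr_ge0|by rewrite mulr_ge0 ?invr_ge0| |].
  rewrite lef_pV2 ?posrE ?qpoch_norm_ge//.
  by rewrite normr_gt0.
apply: ler_pM; [by rewrite invr_ge0|by []| |].
  by rewrite lef_pV2 ?posrE// normr_gt0.
by rewrite normqX lecR ler_wiXn2l//; lia.
Qed.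

Lemma odd_qseries_is_cvg j : cvgn (odd_qseries q j).
Proof. exact: (series_geometric_is_cvg r01 (odd_qseries_term_le j)). Qed.

Lemma odd_lambert_is_cvg j : cvgn (odd_lambert q j).
Proof. exact: (series_geometric_is_cvg r01 (odd_lambert_term_le j)). Qed.

(** In the iterated equation [qpoch q (q ^+ 2) j] is bounded below, [D j] is bounded above, and the
    product of the [- q ^+ i.*2.+1] has modulus at most [r ^+ j]. So [|D 0|] is at most a constant
    times [r ^+ j] for every [j]. *)
Lemma lim_odd_qseries :
  limn (odd_qseries q 0) = qpoch_inf (q ^+ 2) (q ^+ 2) * limn (odd_lambert q 0).
Proof.
set t := qpoch_inf _ _.
have t0 : t != 0 by exact: qpoch_inf_neq0 r01 _ _.
have T_cvg : qpoch (q ^+ 2) (q ^+ 2) @ \oo --> t by exact: qpoch_is_cvg r01 _ _.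
have iter := odd_diff_iter t0 T_cvg odd_qseries_is_cvg odd_lambert_is_cvg T_neq0
  one_minus_neq0.
have r1 : 0 < 1 - r by rewrite subr_gt0; case/andP: r01.
have ub0 : 0 <= qpoch_ub r by exact: expR_ge0.
have lb0 : 0 < qpoch_lb r by exact: qpoch_lb_gt0.
set D := fun j => limn (odd_qseries q j) - t * limn (odd_lambert q j).
have A_le j : `|limn (odd_qseries q j)| <= (qpoch_ub r / (1 - r))%:C%C.
  apply: (cvg_norm_le _ _ (@odd_qseries_is_cvg j)); first by rewrite complex_real.
  by move=> N; apply: sum_geometric_norm_le.
pose b := (qpoch_lb r)^-1 * (1 - r)^-1.
have b0 : 0 <= b by rewrite mulr_ge0 ?invr_ge0// ltW.
have B_le j : `|limn (odd_lambert q j)| <= (b / (1 - r))%:C%C.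
  apply: (cvg_norm_le _ _ (@odd_lambert_is_cvg j)); first by rewrite complex_real.
  by move=> N; apply: sum_geometric_norm_le.
have t_le : `|t| <= (qpoch_ub r)%:C%C.
  apply: (cvg_norm_le _ _ T_cvg); first by rewrite complex_real.
  by move=> N; apply: qpoch_norm_le.
pose M := qpoch_ub r / (1 - r) + qpoch_ub r * (b / (1 - r)).
have D_le j : `|D j| <= M%:C%C.
  rewrite /D (le_trans (ler_normB _ _))// rmorphD lerD// normrM rmorphM.
  by rewrite ler_pM.
(* The final limit argument takes place in the reals. *)
pose d := complex.Re `|D 0%N|.
have dE : `|D 0%N| = d%:C%C by apply: cplx_real_complex; exact: normr_real.
have d_le j : d <= (qpoch_lb r)^-1 * M * r ^+ j.
  rewrite -mulrA ler_pdivlMl//.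
  suff : (qpoch_lb r)%:C%C * `|D 0%N| <= M%:C%C * (r ^+ j)%:C%C.
    by rewrite dE -!rmorphM lecR.
  apply: (@le_trans _ _ `|qpoch q (q ^+ 2) j * D 0%N|).
    by rewrite normrM ler_wpM2r//; exact: qpoch_norm_ge.
  rewrite iter normrM [leLHS]mulrC; apply: ler_pM => //; first exact: D_le.
  rewrite normr_prod; apply: le_trans (_ : \prod_(0 <= i < j) r%:C%C <= _).
    apply: ler_prod => i _; rewrite normr_ge0 /= normrN normqX lecR.
    by rewrite exprS ler_piMr// exprn_ile1.
  by rewrite prodr_const_nat subn0 rmorphXn.
have d0 : d <= 0 := geometric_bound_eq0 r01 d_le.
have : `|D 0%N| <= 0 by rewrite dE -(rmorph0 (real_complex R)) lecR.
by rewrite normr_le0 subr_eq0 => /eqP.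
Qed.

End odd_series_identity.

(** * Assembly of the two identities *)

Lemma qpoch_inf_sqr (K : numClosedFieldType) (q : K) :
  cvgn (qpoch q q) -> cvgn (qpoch (- q) q) ->
  qpoch_inf (q ^+ 2) (q ^+ 2) = qpoch_inf q q * qpoch_inf (- q) q.
Proof.
move=> P_cvg Q_cvg; apply: cvg_lim; first exact: norm_hausdorff.
have -> : qpoch (q ^+ 2) (q ^+ 2) = (fun n => qpoch q q n * qpoch (- q) q n).
  by apply/funext => n; exact: qpoch_sqr.
exact: cvgM P_cvg Q_cvg.
Qed.

Lemma gon_partial_gf_lim (K : numClosedFieldType) (q S : K) :
  cvgn (qpoch q q) -> qpoch_inf q q != 0 -> odd_qseries q 0 @ \oo --> S ->
  gon_partial_gf q @ \oo --> (qpoch_inf q q)^-1 * S.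
Proof.
move=> P_cvg P0 S_cvg.
have -> : gon_partial_gf q = (fun N => (qpoch q q N)^-1 * odd_qseries q 0 N).
  by apply/funext => N; rewrite /odd_qseries seriesEnat.
exact: (cvgM (cvgV P0 P_cvg) S_cvg).
Qed.

Unset Implicit Arguments.

Theorem mainTheorem9 (R : realType) (q : Cplx R) (hq : `|q| < 1) :
  [/\ [/\ cvgn (qpoch q q),
          cvgn (qpoch (- q) q),
          cvg (partial_sum (fun p : GON => q ^+ weight (val p)) @ totally),
          cvgn (fun N => \sum_(1 <= n < N) q ^+ n * qpoch (q ^+ 2) (q ^+ 2) n.-1)
        & cvgn (fun N => \sum_(0 <= n < N)
             q ^+ n.*2.+1 / (1 - q ^+ n.*2.+1) * (qpoch (q ^+ 2) (q ^+ 2) n)^-1)],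
      summability.sum (fun p : GON => q ^+ weight (val p)) =
        (qpoch_inf q q)^-1 *
        \sum_(1 <= n <oo) q ^+ n * qpoch (q ^+ 2) (q ^+ 2) n.-1
    & (qpoch_inf q q)^-1 *
        \sum_(1 <= n <oo) q ^+ n * qpoch (q ^+ 2) (q ^+ 2) n.-1 =
      qpoch_inf (- q) q *
        \sum_(0 <= n <oo)
          q ^+ n.*2.+1 / (1 - q ^+ n.*2.+1) * (qpoch (q ^+ 2) (q ^+ 2) n)^-1].
Proof.
pose r := complex.Re `|q|.
have qr : `|q| = r%:C%C by apply: cplx_real_complex; exact: normr_real.
have r01 : 0 <= r < 1 by rewrite -lecR -ltcR -qr normr_ge0 hq.
have q_le : `|q| <= r%:C%C by rewrite qr.
have q_le1 : `|q| <= 1 by exact: ltW.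
have P_cvg : cvgn (qpoch q q) by exact: qpoch_is_cvg r01 q_le1 q_le.
have Q_cvg : cvgn (qpoch (- q) q).
  by apply: (qpoch_is_cvg r01 _ q_le); rewrite normrN.
have P_neq0 : qpoch_inf q q != 0 by exact: (qpoch_inf_neq0 r01).
(* The case [j = 0] is [z = q]; the summation index is shifted by one. *)
have sumE N : \sum_(1 <= n < N.+1) q ^+ n * qpoch (q ^+ 2) (q ^+ 2) n.-1 =
    odd_qseries q 0 N.
  by rewrite big_add1 /odd_qseries seriesEnat.
have A_cvg : (fun N => \sum_(1 <= n < N) q ^+ n * qpoch (q ^+ 2) (q ^+ 2) n.-1) @ \oo -->
    limn (odd_qseries q 0).
  rewrite -cvg_shiftS; under eq_fun do rewrite sumE.
  exact: (@odd_qseries_is_cvg _ q r r01 qr 0).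
have B_cvg := @odd_lambert_is_cvg _ q r r01 qr 0.
have A_lim : \sum_(1 <= n <oo) q ^+ n * qpoch (q ^+ 2) (q ^+ 2) n.-1 =
    limn (odd_qseries q 0).
  by apply: cvg_lim A_cvg; exact: norm_hausdorff.
split.
- split.
  + exact: P_cvg.
  + exact: Q_cvg.
  + exact: (partial_sum_GON_is_cvg r01 qr).
  + exact: (cvgP _ A_cvg).
  + exact: B_cvg.
- have gon_lim := gon_partial_gf_lim P_cvg P_neq0 (@odd_qseries_is_cvg _ q r r01 qr 0).
  rewrite A_lim; exact: (cvg_unique _ (gon_partial_gf_cvg r01 qr) gon_lim).
(* Factoring [(q^2;q^2)_oo] cancels [(q;q)_oo] and leaves [(-q;q)_oo]. *)
- rewrite A_lim (lim_odd_qseries r01 qr) (qpoch_inf_sqr P_cvg Q_cvg) !mulrA mulVf// mul1r.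
  by congr (_ * _).
Qed.
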